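(* Let $\mathcal{B}$ be an arbitrary category, and let $f\in\mathcal{B}(X,Y)$ and $g\in\mathcal{B}(Z,Y)$ be morphisms in $\mathcal{B}$. Then $g$ is a $0$-kernel of $f$ if and only if it satisfies the following conditions: (a) There is some morphism $g'\in\mathcal{B}(Z,X)$ such that $g=fg'$. (b) If $w\in\mathcal{B}(W,Y)$ is a morphism for which there is some $w'\in\mathcal{B}(W,X)$ such that $w=fw'$, then there is a unique morphism $u\in\mathcal{B}(W,Z)$ satisfying $w=gu$.
   Context: A $0$-kernel of a morphism $f$ in a category is a monomorphism $g$ for which there is a decomposition $f=gh$ with $h$ a split epimorphism. *)

(* Defs.v *)
Set Implicit Arguments.
Unset Strict Implicit.
Unset Printing Implicit Defensive.

Declare Scope cat_scope.
Delimit Scope cat_scope with cat.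
Local Open Scope cat_scope.

(* Morphisms are compared by Leibniz equality, and [comp g f] is
   "g after f": composites are written in the order of application of
   functions, so that f = g h means [f = g ∘ h].  No smallness is imposed:
   objects and morphisms live in independent universes. *)
Record category : Type := Category {
  obj :> Type;
  hom : obj -> obj -> Type;
  idm : forall X, hom X X;
  comp : forall X Y Z, hom Y Z -> hom X Y -> hom X Z;
  comp_idl : forall X Y (f : hom X Y), comp (idm Y) f = f;
  comp_idr : forall X Y (f : hom X Y), comp f (idm X) = f;
  comp_assoc : forall W X Y Z (h : hom Y Z) (g : hom X Y) (f : hom W X),
    comp h (comp g f) = comp (comp h g) f
}.

Arguments hom {c} X Y.
Arguments idm {c} X.
Arguments comp {c X Y Z} g f.

Notation "g ∘ f" := (comp g f) (at level 40, left associativity) : cat_scope.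

Section Morphisms.
Variable B : category.

Definition monomorphism (X Y : B) (g : hom X Y) : Prop :=
  forall (W : B) (u v : hom W X), g ∘ u = g ∘ v -> u = v.

Definition split_epimorphism (X Y : B) (h : hom X Y) : Prop :=
  exists s : hom Y X, h ∘ s = idm Y.

Definition zero_kernel (X Y Z : B) (f : hom X Y) (g : hom Z Y) : Prop :=
  monomorphism g /\ exists h : hom X Z, split_epimorphism h /\ f = g ∘ h.

End Morphisms.

(* Main.v *)
Require Import Defs.
Local Open Scope cat_scope.

(** Conditions (a) and (b) say that [g] is terminal among the morphisms into
    [Y] that factor through [f], i.e. that [g] represents the image of the
    natural map [f ∘ _].  If [f = g ∘ h] with [h] split by [s], then
    [g = f ∘ s], so that [f] and [g] have the same morphisms factoring through
    them, and the factorization through [g] is unique because [g] is a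
    monomorphism.  Conversely, every [g ∘ u] factors through [f] by (a), so
    uniqueness in (b) makes [g] a monomorphism; existence in (b), applied to
    [f] itself, gives [f = g ∘ h], and cancelling [g] in
    [g ∘ (h ∘ g') = f ∘ g' = g] shows that [g'] is a section of [h]. *)

Theorem propositionA2 (B : category) (X Y Z : B) (f : hom X Y) (g : hom Z Y) :
  zero_kernel f g <->
    (exists g' : hom Z X, g = f ∘ g') /\
    (forall (W : B) (w : hom W Y),
       (exists w' : hom W X, w = f ∘ w') ->
       exists! u : hom W Z, w = g ∘ u).
Proof.
  split.
  - intros [mono_g [h [[s hs] f_gh]]]. split.
    + exists s. rewrite f_gh, <- comp_assoc, hs, comp_idr. reflexivity.
    + intros W w [w' w_fw']. exists (h ∘ w').
      assert (w_gu : w = g ∘ (h ∘ w')).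
      { rewrite comp_assoc, <- f_gh. exact w_fw'. }
      split; [exact w_gu|].
      intros v w_gv. apply mono_g. rewrite <- w_gu. exact w_gv.
  - intros [[g' g_fg'] univ].
    assert (mono_g : monomorphism g).
    { intros W u v gu_gv.
      destruct (univ W (g ∘ u)) as [t [_ t_uniq]].
      - exists (g' ∘ u). rewrite comp_assoc, <- g_fg'. reflexivity.
      - rewrite <- (t_uniq u eq_refl). exact (t_uniq v gu_gv). }
    destruct (univ X f) as [h [f_gh _]].
    { exists (idm X). rewrite comp_idr. reflexivity. }
    split; [exact mono_g|].
    exists h. split; [|exact f_gh].
    exists g'. apply mono_g.
    rewrite comp_assoc, <- f_gh, <- g_fg', comp_idr. reflexivity.
Qed.
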